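(* Let $n\ge 2$. 1. The assignment $T_i\mapsto D_i$ ($1\le i\le n-2$), where the down operators $D_i:F_n\to F_n$ are extended linearly to the $\mathbb{Q}$-vector space $\mathbb{Q}F_n$ with basis $F_n$, defines an action of the $0$-Hecke algebra $\mathcal{H}_{n-1}(0)$, and this action is faithful. 2. Each lower interval $[e,w]=\{u\in F_n: u\le w\}$ of $\mathrm{Weak}(F_n)$ ($w\in F_n$) is invariant under this action, i.e. $D_i([e,w])\subseteq[e,w]$ for all $1\le i\le n-2$.
   Context: $S_n$ is the symmetric group on $\{1,\dots,n\}$, with product $(\pi\sigma)(i)=\pi(\sigma(i))$; $(a,b)$ denotes a transposition. Let $c=(1,2,\dots,n)$ be the $n$-cycle. $F_n$ is the set of maximal chains in the lattice $NC(n)$ of non-crossing partitions, identified with the set of words $(t_1,\dots,t_{n-1})$ of transpositions in $S_n$ with $t_1t_2\cdots t_{n-1}=c$. For $1\le i\le n-2$ and $v=(t_1,\dots,t_{n-1})\in F_n$, $R_i(v)$ is obtained from $v$ by replacing $(t_i,t_{i+1})$ by $(t_{i+1}^{t_i},t_i)$, and $L_i(v)$ by replacing $(t_i,t_{i+1})$ by $(t_{i+1},t_i^{t_{i+1}})$, where $g^h=h^{-1}gh$. The Hurwitz graph $G_T(n)$ is the undirected graph on $F_n$ in which distinct $u,v$ are adjacent iff $v=R_i(u)$ or $v=L_i(u)$ for some $i$ (equivalently, the chains differ in exactly one element). It is connected. Put $e=((1,2),(2,3),\dots,(n-1,n))$. The poset $\mathrm{Weak}(F_n)$ is $F_n$ with: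 $u\le v$ iff $u$ lies on a geodesic in $G_T(n)$ from $e$ to $v$. Map $\phi:F_n\to S_{n-1}$: for $w=(t_1,\dots,t_{n-1})\in F_n$ let $\sigma_j=t_jt_{j+1}\cdots t_{n-1}$ ($1\le j\le n-1$) and $\sigma_n=id$. For each $1\le j\le n-1$ there is exactly one $i\in\{1,\dots,n-1\}$ with $\sigma_j(i)>\sigma_{j+1}(i)$; set $\phi(w)(j)=i$. This gives a permutation $\phi(w)\in S_{n-1}$. Descent set: $\mathrm{Des}(\pi)=\{i:\pi(i)>\pi(i+1)\}$ for $\pi\in S_{n-1}$. Down operators: for $1\le i\le n-2$, $D_i:F_n\to F_n$ is given by $D_i(w)=R_i(w)$ if $i\in\mathrm{Des}(\phi(w))$ and $R_i(w)<w$ in $\mathrm{Weak}(F_n)$; $D_i(w)=L_i(w)$ if $i\in\mathrm{Des}(\phi(w))$ and $L_i(w)<w$; $D_i(w)=w$ if $i\notin\mathrm{Des}(\phi(w))$. (This is well defined: if $i\in\mathrm{Des}(\phi(w))$ then at least one of $R_i(w),L_i(w)$ is $<w$, and if both are then they are equal.) The $0$-Hecke algebra $\mathcal{H}_m(0)$ is the $\mathbb{Q}$-algebra generated by $T_1,\dots,T_{m-1}$ with defining relations $T_i^2=T_i$ for all $i$; $T_iT_j=T_jT_i$ for $|i-j|>1$; $T_iT_{i+1}T_i=T_{i+1}T_iT_{i+1}$ for $1\le i\le m-2$. *)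

(* Defs.v *)
From HB Require Import structures.
From mathcomp Require Import all_boot all_order all_algebra all_fingroup.
From mathcomp Require Import ring_quotient generic_quotient.
From mathcomp Require Import boolp.
From mathcomp Require Import xfinmap monalg.

Set Implicit Arguments.
Unset Strict Implicit.
Unset Printing Implicit Defensive.

Import GRing.Theory.

(* Everything is 0-based: k : 'I_n stands for k+1 in {1, .., n}; an index      *)
(* k : 'I_n.-1 is one for which both k and k+1 lie in 'I_n.                    *)
Definition lo n (k : 'I_n.-1) : 'I_n := widen_ord (leq_pred n) k.
Definition hi n (k : 'I_n.-1) : 'I_n := ordS (lo k).

Lemma val_hi n (k : 'I_n.-1) : hi k = k.+1 :> nat.
Proof. by case: n k => [[]//|n] k /=; rewrite modn_small ?ltnS. Qed.

(* MathComp's product in 'S_n composes left to right: (s * t) i = t (s i).     *)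
(* pmul is the right-to-left one: pmul s t i = s (t i).                        *)
Definition pmul n (s t : 'S_n) : 'S_n := (t * s)%g.
(* g^h = h^-1 g h for the product pmul. *)
Definition pconj n (g h : 'S_n) : 'S_n := pmul (pmul h^-1%g g) h.
Definition pprod n (w : seq 'S_n) : 'S_n := foldr (@pmul n) 1%g w.

Lemma pmulE n (s t : 'S_n) i : pmul s t i = s (t i).
Proof. by rewrite /pmul permM. Qed.

Lemma pprod_cat n (u v : seq 'S_n) : pprod (u ++ v) = pmul (pprod u) (pprod v).
Proof.
elim: u => [|t u IH] /=; first by rewrite /pmul mulg1.
by rewrite IH /pmul mulgA.
Qed.

Definition cyc n : 'S_n := perm (@ordS_inj n).

Definition is_transp n (t : 'S_n) : bool :=
  [exists a, exists b, (a != b) && (t == tperm a b)].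

Lemma is_transp_conj n (g h : 'S_n) : is_transp g -> is_transp (pconj g h).
Proof.
case/existsP=> a /existsP[b /andP[ab /eqP->]].
rewrite /pconj /pmul mulgA.
have -> : (h * tperm a b * h^-1 = tperm (h^-1 a) (h^-1 b))%g.
  by rewrite -tpermJ conjgE invgK -mulgA.
apply/existsP; exists (h^-1%g a); apply/existsP; exists (h^-1%g b).
by rewrite (inj_eq perm_inj) ab eqxx.
Qed.

Definition in_F n (w : seq 'S_n) : bool :=
  all (@is_transp n) w && (pprod w == cyc n).

(* Maximal chains of NC(n), as minimal factorizations of the cycle cyc n. *)
Record F n := MkF { word :> (n.-1).-tuple 'S_n; wordP : in_F word }.

HB.instance Definition _ n := [isSub for @word n].
HB.instance Definition _ n := [Finite of F n by <:].

Definition letter n (w : seq 'S_n) (k : nat) : 'S_n := nth 1%g w k.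

(* Overwrites the letters of w in positions i and i+1 by a and b. *)
Definition replace2 n (w : (n.-1).-tuple 'S_n) (i : nat) (a b : 'S_n) :
    (n.-1).-tuple 'S_n :=
  [tuple if k == i :> nat then a else if k == i.+1 :> nat then b else letter w k
   | k < n.-1].

Lemma replace2_in_F n (w : (n.-1).-tuple 'S_n) (i : 'I_n.-2) (a b : 'S_n) :
  in_F w -> is_transp a -> is_transp b ->
  pmul a b = pmul (letter w i) (letter w i.+1) ->
  in_F (replace2 w i a b).
Proof.
case/andP=> tw /eqP pw ta tb eab; set w' := replace2 _ _ _ _.
have i1 : i.+1 < n.-1 by case: i {eab w'} => i /=; case: (n.-1).
have i0 : i < n.-1 by apply: ltnW.
have nw' k : k < n.-1 -> nth 1%g w' k =
    if k == i then a else if k == i.+1 then b else letter w k.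
  by move=> kn; rewrite -[k]/(val (Ordinal kn)) -tnth_nth tnth_mktuple.
have split2 (s : (n.-1).-tuple 'S_n) : s = take i s ++
    [:: letter s i, letter s i.+1 & drop i.+2 s] :> seq _.
  by rewrite -!drop_nth ?size_tuple // cat_take_drop.
have eT : take i w' = take i w.
  apply: (@eq_from_nth _ 1%g) => [|k]; rewrite !size_takel ?size_tuple ?(ltnW i0) //.
  move=> ki; rewrite !nth_take // nw' ?(ltn_trans ki) //.
  by rewrite (ltn_eqF ki) (ltn_eqF (ltnW _)).
have eD : drop i.+2 w' = drop i.+2 w.
  apply: (@eq_from_nth _ 1%g) => [|k]; rewrite !size_drop !size_tuple //.
  move=> ki; rewrite !nth_drop nw'; last by rewrite -ltn_subRL.
  by rewrite !gtn_eqF // addSn ltnS ?leq_addr // leqW // leq_addr.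
have e0 : letter w' i = a by rewrite /letter nw' // eqxx.
have e1 : letter w' i.+1 = b by rewrite /letter nw' // (gtn_eqF (ltnSn i)) eqxx.
apply/andP; split.
  apply/allP => t /(nthP 1%g)[k]; rewrite size_tuple => kn <-; rewrite nw' //.
  case: ifP => // _; case: ifP => // _.
  by apply: (allP tw); rewrite mem_nth // size_tuple.
rewrite -pw (split2 w') [in X in _ == X](split2 w) !pprod_cat eT eD e0 e1 /=.
have assoc (x y z : 'S_n) : pmul x (pmul y z) = pmul (pmul x y) z.
  by rewrite /pmul mulgA.
by rewrite (assoc a) (assoc (letter w i)) eab.
Qed.

Lemma is_transp_letter n (w : F n) k : k < n.-1 -> is_transp (letter w k).
Proof.
case: w => w /= /andP[tw _] kn; apply: (allP tw).
by rewrite mem_nth // size_tuple.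
Qed.

Lemma R_subproof n (i : 'I_n.-2) (w : F n) :
  in_F (replace2 w i (pconj (letter w i.+1) (letter w i)) (letter w i)).
Proof.
have i1 : i.+1 < n.-1 by case: i => i /=; case: (n.-1).
have i0 : i < n.-1 by apply: ltnW.
apply: replace2_in_F; rewrite ?(is_transp_conj, is_transp_letter) ?wordP //.
have/existsP[a /existsP[b /andP[_ /eqP->]]] := is_transp_letter w i0.
by rewrite /pconj /pmul !mulgA tpermV tperm2 mul1g.
Qed.

Lemma L_subproof n (i : 'I_n.-2) (w : F n) :
  in_F (replace2 w i (letter w i.+1) (pconj (letter w i) (letter w i.+1))).
Proof.
have i1 : i.+1 < n.-1 by case: i => i /=; case: (n.-1).
have i0 : i < n.-1 by apply: ltnW.
apply: replace2_in_F; rewrite ?(is_transp_conj, is_transp_letter) ?wordP //.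
by rewrite /pconj /pmul -!mulgA mulVg mulg1.
Qed.

Definition Rmove n (i : 'I_n.-2) (w : F n) : F n := MkF (R_subproof i w).
Definition Lmove n (i : 'I_n.-2) (w : F n) : F n := MkF (L_subproof i w).

Definition hurwitz n : rel (F n) := fun u v =>
  (u != v) && [exists i : 'I_n.-2, (v == Rmove i u) || (v == Lmove i u)].

(* Letter k is the transposition (k, k+1); hi is never wrapped around here.   *)
Definition e_word n : (n.-1).-tuple 'S_n :=
  [tuple tperm (lo k) (hi k) | k < n.-1].

Lemma e_subproof n : in_F (e_word n).
Proof.
case: n => [|n].
  apply/andP; split; first by rewrite (size0nil (size_tuple (e_word 0))).
  by apply/eqP/permP=> -[].
have nthe k (kn : k < n) : nth 1%g (e_word n.+1) k =
    tperm (lo (Ordinal kn : 'I_n.+1.-1)) (hi (Ordinal kn : 'I_n.+1.-1)).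
  by rewrite -[k in LHS]/(val (Ordinal kn : 'I_n.+1.-1)) -tnth_nth tnth_mktuple.
apply/andP; split.
  apply/allP=> t /(nthP 1%g)[k]; rewrite size_tuple => kn <-; rewrite nthe.
  apply/existsP; exists (lo (Ordinal kn : 'I_n.+1.-1)).
  apply/existsP; exists (hi (Ordinal kn : 'I_n.+1.-1)).
  rewrite eqxx andbT; apply/eqP=> /(congr1 (@nat_of_ord _)).
  by rewrite val_hi => /n_Sn.
have H d : d <= n -> forall i : 'I_n.+1,
    pprod (drop (n - d) (e_word n.+1)) i =
    (if i < n - d then i : nat else if i < n then i.+1 else n - d) :> nat.
  elim: d => [|d IH] dn i.
    rewrite subn0 drop_oversize ?size_tuple //= perm1.
    by have := ltn_ord i; rewrite ltnS; case: ltngtP.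
  have kn : n - d.+1 < n by rewrite ltn_subrL (leq_ltn_trans _ dn).
  rewrite (drop_nth 1%g) ?size_tuple //= subnSK //.
  rewrite pmulE nthe; set s := pprod _; have {IH} := IH (ltnW dn) i.
  rewrite -/s; have eS : (n - d) = (n - d.+1).+1 by rewrite subnSK.
  set k := n - d.+1 in kn eS *; rewrite eS => Hs.
  have hk : hi (Ordinal kn : 'I_n.+1.-1) = k.+1 :> nat by rewrite val_hi.
  have := ltn_ord i; rewrite ltnS => ile.
  case: tpermP => [sk|sk|/eqP n1 /eqP n2].
  - move: Hs; rewrite sk hk /=; case: ifP => [ik ki|ik].
      by rewrite -ki ltnn kn.
    case: ifP => [_ ki|_ /n_Sn //].
    by rewrite ki ltnS leqnSn in ik.
  - move: Hs; rewrite sk hk /=; case: ifP => [ik ki|ik].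
      by rewrite -ki ltnn in ik.
    case: ifP => [iN [ki]|iN _].
      by rewrite ki leqnn in ik.
    by rewrite ltnNge (leq_trans (ltnW kn)) // leqNgt iN.
  - rewrite Hs; move: n1 n2; rewrite -!(inj_eq (@ord_inj _)) hk /= Hs.
    case: ifP => [ik|ik]; first by move=> ne _; rewrite ltn_neqAle ne -ltnS ik.
    case: ifP => [iN _ _|iN _]; last by rewrite eqxx.
    by rewrite ltnNge ltnW // ltnNge -ltnS ik.
apply/eqP/permP=> i; apply/val_inj.
have := H n (leqnn n) i; rewrite subnn drop0 => Hi.
apply: etrans Hi _; rewrite permE /=.
case: ltnP => [iN|Ni]; first by rewrite modn_small.
have -> : i = n :> nat by apply/eqP; rewrite eqn_leq Ni -ltnS ltn_ord.
by rewrite modnn.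
Qed.

Definition e n : F n := MkF (e_subproof n).

Definition geodesic n (u v : F n) (p : seq (F n)) : Prop :=
  [/\ path (@hurwitz n) u p, last u p = v &
      forall q, path (@hurwitz n) u q -> last u q = v -> size p <= size q].

Definition weak_le n (u v : F n) : Prop :=
  exists2 p, geodesic (e n) v p & u \in e n :: p.

Definition weak_lt n (u v : F n) : Prop := weak_le u v /\ u <> v.

(* The product of the letters in (0-based) positions >= j. *)
Definition sigma n (w : seq 'S_n) (j : nat) : 'S_n := pprod (drop j w).

(* The default value j is never used: see phi_funP. *)
Definition phi_fun n (w : F n) (j : 'I_n.-1) : 'I_n.-1 :=
  odflt j [pick i : 'I_n.-1 | sigma w j.+1 (lo i) < sigma w j (lo i)].

Lemma sigma_rises n (w : F n) (j : nat) (i1 i2 : 'I_n) : j < n.-1 ->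
  sigma w j.+1 i1 < sigma w j i1 -> sigma w j.+1 i2 < sigma w j i2 -> i1 = i2.
Proof.
move=> jn; have -> : sigma w j = pmul (letter w j) (sigma w j.+1).
  by rewrite /sigma (drop_nth 1%g) ?size_tuple.
have /existsP[a /existsP[b /andP[_ /eqP->]]] := is_transp_letter w jn.
rewrite !pmulE.
by case: tpermP => [e1|e1|_ _]; case: tpermP => [e2|e2|_ _];
  rewrite ?ltnn // ?e1 ?e2 => h1 h2; [apply: (@perm_inj _ (sigma w j.+1)); rewrite e1 e2
  | have := ltn_trans h1 h2; rewrite ltnn
  | have := ltn_trans h1 h2; rewrite ltnn
  | apply: (@perm_inj _ (sigma w j.+1)); rewrite e1 e2].
Qed.

Lemma exists_rise n (w : F n) (i : 'I_n.-1) :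
  exists j : 'I_n.-1, sigma w j.+1 (lo i) < sigma w j (lo i).
Proof.
apply/existsP; apply: contraT; rewrite negb_exists => /forallP H.
have Hk k : k <= n.-1 -> sigma w 0 (lo i) <= sigma w k (lo i).
  elim: k => // k IH kn; apply: leq_trans (IH (ltnW kn)) _.
  by have := H (Ordinal kn); rewrite -leqNgt.
have := Hk _ (leqnn _); rewrite /sigma drop0 drop_oversize ?size_tuple //= perm1.
have /andP[_ /eqP->] := wordP w.
by rewrite permE -/(hi i) val_hi ltnn.
Qed.

Lemma phi_funP n (w : F n) (i j : 'I_n.-1) :
  (sigma w j.+1 (lo i) < sigma w j (lo i)) = (phi_fun w j == i).
Proof.
pose r (i : 'I_n.-1) := xchoose (exists_rise w i).
have rP k : sigma w (r k).+1 (lo k) < sigma w (r k) (lo k).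
  exact: (xchooseP (exists_rise w k)).
have loI : injective (@lo n) by move=> x y /(congr1 val) /= /val_inj.
have rI : injective r.
  move=> x y exy; apply: loI; apply: (sigma_rises (ltn_ord (r x)) (rP x)).
  by rewrite exy.
have Hphi : sigma w j.+1 (lo (phi_fun w j)) < sigma w j (lo (phi_fun w j)).
  rewrite /phi_fun; case: pickP => //= none.
  have [g _ gK] := injF_bij rI.
  by have := rP (g j); rewrite gK none.
apply/idP/eqP => [h|<- //]; apply: loI.
exact: (sigma_rises (ltn_ord j) Hphi h).
Qed.

Lemma phi_inj n (w : F n) : injective (phi_fun w).
Proof.
have [g gK Kg] : bijective (phi_fun w); last exact: can_inj gK.
have ex (i : 'I_n.-1) : exists j, phi_fun w j == i.
  by have [j hj] := exists_rise w i; exists j; rewrite -phi_funP.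
pose g i := xchoose (ex i).
have gK : cancel g (phi_fun w) by move=> i; apply/eqP/(xchooseP (ex i)).
exact: (bij_can_bij (injF_bij (can_inj gK)) gK).
Qed.

Definition phi n (w : F n) : 'S_n.-1 := perm (@phi_inj n w).

Definition Des m (p : 'S_m) : {set 'I_m.-1} := [set i | p (hi i) < p (lo i)].

(* When both moves go down they coincide, so the order of the tests is         *)
(* irrelevant; the third branch of the inner conditional is never reached.     *)
Definition down n (i : 'I_n.-2) (w : F n) : F n :=
  if i \in Des (phi w) then
    if `[< weak_lt (Rmove i w) w >] then Rmove i w
    else if `[< weak_lt (Lmove i w) w >] then Lmove i w
    else w
  else w.

Local Open Scope ring_scope.

(* The two-sided ideal generated by the differences x - y with x ~ y. *)
Inductive span_ideal (A : nzRingType) (rel : A -> A -> Prop) : A -> Prop :=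
| SpanIdeal0 : span_ideal rel 0
| SpanIdealGen (a b x y : A) : rel x y -> span_ideal rel (a * (x - y) * b)
| SpanIdealD (x y : A) :
    span_ideal rel x -> span_ideal rel y -> span_ideal rel (x + y).

Section SpanIdeal.
Variables (A : nzRingType) (rel : A -> A -> Prop).

Lemma span_idealM a b x : span_ideal rel x -> span_ideal rel (a * x * b).
Proof.
elim=> [|a' b' x1 y1 r|x1 y1 _ h1 _ h2].
- by rewrite mulr0 mul0r; apply: SpanIdeal0.
- by rewrite !mulrA -(mulrA _ b'); apply: SpanIdealGen.
- by rewrite mulrDr mulrDl; apply: SpanIdealD.
Qed.

Lemma span_idealN x : span_ideal rel x -> span_ideal rel (- x).
Proof. by move/(span_idealM (-1) 1); rewrite mulr1 mulN1r. Qed.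

End SpanIdeal.

Section Hecke0.
Variable m : nat.

(* The monoid algebra of the free monoid, i.e. the free associative algebra. *)
Definition freealg := {malg rat[{fmonom 'I_m.-1}]}.
HB.instance Definition _ := GRing.Lalgebra.on freealg.

Definition gen (i : 'I_m.-1) : freealg := << fmu i >>.

Inductive hecke0_rel : freealg -> freealg -> Prop :=
| HeckeIdem (i : 'I_m.-1) : hecke0_rel (gen i * gen i) (gen i)
| HeckeComm (i j : 'I_m.-1) : (i.+1 < j)%N || (j.+1 < i)%N ->
    hecke0_rel (gen i * gen j) (gen j * gen i)
| HeckeBraid (i j : 'I_m.-1) : j = i.+1 :> nat ->
    hecke0_rel (gen i * gen j * gen i) (gen j * gen i * gen j).

Definition hecke0_ideal : {pred freealg} :=
  fun x => `[< span_ideal hecke0_rel x >].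

Lemma hecke0_ideal_closed : zmod_closed hecke0_ideal.
Proof.
split=> [|x y /asboolP hx /asboolP hy]; apply/asboolP; first exact: SpanIdeal0.
by apply: SpanIdealD => //; apply: span_idealN.
Qed.
HB.instance Definition _ :=
  GRing.isZmodClosed.Build freealg hecke0_ideal hecke0_ideal_closed.


Definition Hecke0 := Quotient.quot hecke0_ideal.
HB.instance Definition _ := GRing.Zmodule.on Hecke0.
HB.instance Definition _ := EqQuotient.on Hecke0.

Definition toH (x : freealg) : Hecke0 := \pi_Hecke0%qT x.

Lemma toHK (x : Hecke0) : toH (repr x) = x.
Proof. exact: reprK. Qed.

Lemma toHE x y : toH x = toH y <-> span_ideal hecke0_rel (x - y).
Proof.
split=> [/eqP|h]; first by rewrite -Quotient.idealrBE => /asboolP.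
by apply/eqP; rewrite -Quotient.idealrBE; apply/asboolP.
Qed.

Lemma toHD x y : toH (x + y) = toH x + toH y.
Proof. exact: Quotient.pi_add. Qed.

Lemma repr_toH x : span_ideal hecke0_rel (repr (toH x) - x).
Proof. by apply/toHE; rewrite toHK. Qed.

Definition hone : Hecke0 := toH 1.
Definition hmul (x y : Hecke0) : Hecke0 := toH (repr x * repr y).
Definition hscale (c : rat) (x : Hecke0) : Hecke0 := toH (c *: repr x).

Lemma toHM x y : hmul (toH x) (toH y) = toH (x * y).
Proof.
apply/toHE; set x' := repr _; set y' := repr _.
have -> : x' * y' - x * y = 1 * (x' - x) * y' + x * (y' - y) * 1.
  by rewrite mul1r mulr1 mulrBl mulrBr addrA subrK.
by apply: SpanIdealD; apply: span_idealM; apply: repr_toH.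
Qed.

Lemma toHZ c x : hscale c (toH x) = toH (c *: x).
Proof.
apply/toHE; rewrite -scalerBr -[X in c *: X]mul1r scalerAl.
by rewrite -[X in span_ideal _ X]mulr1; apply: span_idealM; apply: repr_toH.
Qed.

Lemma hmulA : associative hmul.
Proof. by move=> x y z; rewrite -(toHK x) -(toHK y) -(toHK z) !toHM mulrA. Qed.

Lemma hmul1 : left_id hone hmul.
Proof. by move=> x; rewrite -(toHK x) toHM mul1r. Qed.

Lemma hmulr1 : right_id hone hmul.
Proof. by move=> x; rewrite -(toHK x) toHM mulr1. Qed.

Lemma hmulDl : left_distributive hmul +%R.
Proof.
move=> x y z; rewrite -(toHK x) -(toHK y) -(toHK z).
by rewrite -toHD !toHM mulrDl toHD.
Qed.

Lemma hmulDr : right_distributive hmul +%R.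
Proof.
move=> x y z; rewrite -(toHK x) -(toHK y) -(toHK z).
by rewrite -toHD !toHM mulrDr toHD.
Qed.

(* T_i |-> 1 kills the relations and sends 1 to 1, whence 1 <> 0 in Hecke0. *)
Definition one_mor (s : {fmonom 'I_m.-1}) : rat := 1.

Lemma one_mor_morph : mmorphism one_mor.
Proof. by split=> // x y; rewrite /one_mor mulr1. Qed.
HB.instance Definition _ := isMultiplicative.Build _ _ one_mor one_mor_morph.

Lemma hone_neq0 : hone != 0.
Proof.
have H x : span_ideal hecke0_rel x -> mmap idfun one_mor x = 0.
  elim=> [|a b x1 y1 r|x1 y1 _ h1 _ h2]; first exact: mmap0.
    rewrite !rmorphM rmorphB /=.
    suff -> : mmap idfun one_mor x1 = mmap idfun one_mor y1.
      by rewrite subrr mulr0 mul0r.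
    have g1 i : mmap idfun one_mor (gen i) = 1 by rewrite /gen mmapU mulr1.
    by case: r => [i|i j _|i j _]; rewrite !rmorphM /= !g1 ?mulr1.
  by rewrite rmorphD /= h1 h2 addr0.
apply/eqP; have -> : (0 : Hecke0) = toH 0 
  by apply: (addrI (toH 0)); rewrite -toHD !addr0.
by move/toHE; rewrite subr0 => /H; rewrite rmorph1 => /eqP; rewrite oner_eq0.
Qed.

HB.instance Definition _ := GRing.Zmodule_isNzRing.Build Hecke0
  hmulA hmul1 hmulr1 hmulDl hmulDr hone_neq0.

Lemma hscaleA a b x : hscale a (hscale b x) = hscale (a * b) x.
Proof. by rewrite -(toHK x) !toHZ scalerA. Qed.

Lemma hscale1 : left_id 1 hscale.
Proof. by move=> x; rewrite -(toHK x) toHZ scale1r. Qed.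

Lemma hscaleDr : right_distributive hscale +%R.
Proof.
by move=> c x y; rewrite -(toHK x) -(toHK y) -toHD !toHZ scalerDr toHD.
Qed.

Lemma hscaleDl x : {morph hscale^~ x : a b / a + b}.
Proof. by move=> a b; rewrite -(toHK x) !toHZ scalerDl toHD. Qed.

HB.instance Definition _ := GRing.Zmodule_isLmodule.Build rat Hecke0
  hscaleA hscale1 hscaleDr hscaleDl.

Lemma hscaleAl c (x y : Hecke0) : c *: (x * y) = (c *: x) * y.
Proof.
rewrite -(toHK x) -(toHK y) !/(_ *: _) /= !/(_ * _) /=.
by rewrite !(toHM, toHZ) scalerAl.
Qed.

HB.instance Definition _ := GRing.Lmodule_isLalgebra.Build rat Hecke0 hscaleAl.

Lemma freealg_mulC (c : rat) (x : freealg) : x * c%:MP = c *: x.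
Proof.
rewrite malgM_def malgZ_def fgmulgU; apply/eq_bigr => k _.
by rewrite mulm1 mulrC.
Qed.

Lemma hscaleAr c (x y : Hecke0) : c *: (x * y) = x * (c *: y).
Proof.
rewrite -(toHK x) -(toHK y) !/(_ *: _) /= !/(_ * _) /=.
by rewrite !(toHM, toHZ) -!freealg_mulC mulrA.
Qed.

HB.instance Definition _ := GRing.Lalgebra_isAlgebra.Build rat Hecke0 hscaleAr.

Definition heckeT (i : 'I_m.-1) : Hecke0 := toH (gen i).

End Hecke0.

(* A left module structure of the algebra A on the vector space V, given by    *)
(* its structure map; equivalently an algebra morphism from A to End(V).       *)
Record is_action (A : algType rat) (V : lmodType rat)
    (act : A -> V -> V) : Prop := {
  act_linear_l : forall v, linear (act^~ v);
  act_linear_r : forall a, linear (act a);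
  act_one : forall v, act 1 v = v;
  act_mul : forall a b v, act (a * b) v = act a (act b v)
}.

Definition is_faithful (A : algType rat) (V : lmodType rat)
    (act : A -> V -> V) : Prop :=
  forall a, (forall v, act a v = 0) -> a = 0.

Definition QF n := {ffun F n -> rat^o}.
HB.instance Definition _ n := Vector.on (QF n).

Definition basisF n (w : F n) : QF n := [ffun u => (u == w)%:R].

Definition lin_ext n (f : F n -> F n) (v : QF n) : QF n :=
  \sum_(w : F n) v w *: basisF (f w).

Definition lower_interval n (w : F n) : F n -> Prop := fun u => weak_le u w.

(* Main.v *)
From HB Require Import structures.
From mathcomp Require Import all_boot all_order all_algebra all_fingroup zify.
From mathcomp Require Import boolp generic_quotient xfinmap monalg.
Require Import Defs.

(** Let [sigma w j] be the product of the letters of [w] from position [j] on. The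
    labels [phi w k] with [j <= k] are exactly the [p] with [sigma w j p > p]
    ([exceedance]). Hence the labels between two partial products form a set that
    depends only on these products, and there is only one way to interpolate
    between them with increasing labels ([segment_unique]). This uniqueness is the
    engine of the proof.

    A move at [i] changes one partial product, so it keeps the permutation [phi w]
    or exchanges its values at [i] and [i.+1] ([phi_agree]), and one of the two
    moves always exchanges them ([swap_labels]). The number of inversions of
    [phi w] therefore changes by at most one along an edge; since a chain without
    descent is [e], it is the distance from [e] ([geodesicP]). It follows that
    [down i] sorts the labels at [i] and [i.+1], keeps all other partial products
    ([down_desc]), and goes down in the weak order. Lower intervals are invariant
    because the weak order is transitive.

    The two sides of each relation of the 0-Hecke algebra sort the labels on the
    same segments and keep the products elsewhere, so they agree by uniqueness;
    the operators thus define an action of the free algebra that kills the ideal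
    of relations.

    For faithfulness, every word equals one of at most [m`!] normal forms, where
    [m = n.-1] ([normal_form_word]). Start from a chain labelled by the reversal:
    sorting adjacent labels reaches every permutation of [m] letters
    ([top_chain_reach]). So the normal forms carry this chain to chains with
    pairwise distinct labels, and an element acting by zero has all its
    coefficients equal to zero. *)

Set Implicit Arguments.
Unset Strict Implicit.
Unset Printing Implicit Defensive.

(** * Partial products and labels *)

Section PartialProducts.
Variable n : nat.
Implicit Types (w u v : F n) (j k : 'I_n.-1).

Lemma lo_inj : injective (@lo n).
Proof. by move=> x y /(congr1 val) /= /val_inj. Qed.

Lemma phiE w j : phi w j = phi_fun w j.
Proof. by rewrite permE. Qed.

Lemma phi_onto w (p : 'I_n.-1) : exists j, p = phi w j.
Proof. by exists ((phi w)^-1%g p); rewrite permKV. Qed.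

Lemma sigma0 w : sigma w 0 = cyc n.
Proof. by rewrite /sigma drop0; case/andP: (wordP w) => _ /eqP. Qed.

Lemma sigma_over w a : n.-1 <= a -> sigma w a = 1%g.
Proof. by move=> na; rewrite /sigma drop_oversize ?size_tuple. Qed.

Lemma sigmaS w a : a < n.-1 -> sigma w a = pmul (letter w a) (sigma w a.+1).
Proof. by move=> an; rewrite /sigma (drop_nth 1%g) ?size_tuple. Qed.

Lemma F_ext u v : (forall a, sigma u a = sigma v a) -> u = v.
Proof.
move=> H; suff eL a : a < n.-1 -> letter u a = letter v a.
  apply/val_inj/val_inj/(@eq_from_nth _ (1%g : 'S_n)); rewrite !size_tuple //.
move=> an; have := H a; rewrite (sigmaS u an) (sigmaS v an) H /pmul; exact: mulgI.
Qed.

Lemma sigma_step w j (p := lo (phi w j)) :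
  letter w j = tperm (sigma w j.+1 p) (sigma w j p) /\
  sigma w j.+1 p < sigma w j p.
Proof.
have := phi_funP w (phi w j) j; rewrite phiE eqxx -/(lo _) -phiE -/p => lt.
split=> //; move: lt; rewrite (sigmaS w (ltn_ord j)) pmulE.
have /existsP[a /existsP[b /andP[_ /eqP->]]] := is_transp_letter w (ltn_ord j).
by case: tpermP => [->|->|_ _]; rewrite ?ltnn // tpermC.
Qed.

Lemma sigma_noninc w j (x : 'I_n) :
  x != lo (phi w j) -> sigma w j x <= sigma w j.+1 x.
Proof.
rewrite leqNgt => xp; apply/negP => lt.
have [_ lt'] := sigma_step w j.
by case/eqP: xp; apply: sigma_rises lt lt'.
Qed.

(** A position that does not rise can only move down, and it starts at the
    identity and ends at the cycle (products grow as the index decreases); so it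
    exceeds itself exactly between its rise and the end. This is what makes [phi]
    readable off the products. *)
Lemma exceedance w k (p := phi w k) a : (p < sigma w a (lo p)) = (a <= k).
Proof.
have far j : j != k -> lo p != lo (phi w j).
  by apply: contraNneq => /lo_inj/perm_inj->.
case: (leqP a k) => [ak|]; last first.
  move=> ka; apply: negbTE; rewrite -leqNgt; move: ka.
  have [d] := ubnP (n.-1 - a); elim: d a => // d IH a ad ka.
  have [na|an] := leqP n.-1 a; first by rewrite sigma_over // perm1.
  have ak : Ordinal an != k by rewrite -val_eqE /= gtn_eqF.
  apply: leq_trans (sigma_noninc (far _ ak)) (IH _ _ (leqW ka)).
  by rewrite -ltnS (leq_trans _ ad) // ltnS ltn_sub2l.
suff: sigma w 0 (lo p) <= sigma w a (lo p).
  by rewrite sigma0 permE -/(hi p) val_hi.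
elim: a ak => // a IH ak; apply: leq_trans (IH (ltnW ak)) _.
have an : a < n.-1 := ltn_trans ak (ltn_ord k).
by apply: (@sigma_noninc w (Ordinal an)); apply: far; rewrite -val_eqE /= ltn_eqF.
Qed.

(** An element that keeps exceeding itself is untouched by a smaller label [p]:
    the transposition of that step moves one position down to a value at most
    [p]. *)
Lemma sigma_fixed w j (q : 'I_n.-1) :
  phi w j < q -> q < sigma w j (lo q) -> q < sigma w j.+1 (lo q) ->
  sigma w j (lo q) = sigma w j.+1 (lo q).
Proof.
move=> pq qj; have [eT _] := sigma_step w j.
have := exceedance w j j.+1; rewrite ltnn => /negbT; rewrite -leqNgt => le_p.
rewrite (sigmaS w (ltn_ord j)) pmulE {}eT in qj *; set p := phi w j in pq le_p qj *.
case: tpermP qj => [/perm_inj/lo_inj eqp|_|//].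
  by rewrite eqp ltnn in pq.
by move=> qlt; have := ltn_trans (leq_ltn_trans le_p pq) qlt; rewrite ltnn.
Qed.

(** The labels used on a segment are the exceedances gained there. If they
    increase, the last of them is the largest. It belongs to the step next to
    [b], and the other steps of the segment leave its position alone, so this
    step is determined by the two ends; the others follow by induction. *)
Lemma segment_unique u v a b : b <= n.-1 -> a <= b ->
  sigma u a = sigma v a -> sigma u b = sigma v b ->
  (forall j k, a <= j -> j < k -> k < b -> phi u j < phi u k) ->
  (forall j k, a <= j -> j < k -> k < b -> phi v j < phi v k) ->
  forall l, a <= l -> l <= b -> sigma u l = sigma v l.
Proof.
move=> + + ea; elim: b => [|b IH] bn ab eb ascu ascv l al lb.
  by have -> : l = a by apply/eqP; rewrite eqn_leq al (leq_trans lb).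
have [eab|{}ab] : a = b.+1 \/ a <= b by move: ab; rewrite leq_eqVlt => /predU1P.
  by have -> : l = a by apply/eqP; rewrite eqn_leq al eab lb.
have [->//|{}lb] : l = b.+1 \/ l <= b.
  by move: lb; rewrite leq_eqVlt => /predU1P.
pose k : 'I_n.-1 := Ordinal bn.
(* In both chains the step next to [b.+1] carries the largest exceedance gained. *)
have le_last w1 w2 : sigma w1 a = sigma w2 a -> sigma w1 b.+1 = sigma w2 b.+1 ->
    (forall j k, a <= j -> j < k -> k < b.+1 -> phi w2 j < phi w2 k) ->
    phi w1 k <= phi w2 k.
  move=> e1 e2 asc; have [j ej] := phi_onto w2 (phi w1 k).
  have aj : a <= j by rewrite -(exceedance w2 j) -ej -e1 exceedance.
  have : j < b.+1 by rewrite ltnNge -(exceedance w2 j) -ej -e2 exceedance /= ltnn.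
  rewrite ej ltnS leq_eqVlt => /predU1P[jk|jb]; last by apply: ltnW; apply: asc.
  by rewrite (_ : j = k) //; apply: val_inj.
have eq : phi u k = phi v k.
  by apply/val_inj/eqP; rewrite eqn_leq !le_last.
(* The position of that label rises straight to its final value. *)
have keep w : (forall j k, a <= j -> j < k -> k < b.+1 -> phi w j < phi w k) ->
    sigma w b (lo (phi w k)) = sigma w a (lo (phi w k)).
  move=> asc; suff H d : d <= b - a ->
      sigma w (b - d) (lo (phi w k)) = sigma w b (lo (phi w k)).
    by rewrite -(H _ (leqnn _)) subKn.
  elim: d => [|d IHd] db; first by rewrite subn0.
  have lt : b - d.+1 < b by lia.
  rewrite -IHd ?(ltnW db) //; have eS : b - d = (b - d.+1).+1 by lia.
  rewrite eS; have dn : b - d.+1 < n.-1 := ltn_trans lt bn.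
  apply: (@sigma_fixed w (Ordinal dn)); rewrite ?exceedance ?asc //=; lia.
have ebb : sigma u b = sigma v b.
  rewrite (sigmaS u bn) (sigmaS v bn) eb; congr pmul.
  have [-> _] := sigma_step u k; have [-> _] := sigma_step v k.
  by rewrite !keep // eq ea /= eb.
by apply: IH lb => //; [apply: ltnW | move=> j1 j2 h1 h2 h3; apply: ascu|
   move=> j1 j2 h1 h2 h3; apply: ascv]; rewrite // ltnW.
Qed.

Definition agree_off i u v := forall a, a != i -> sigma u a = sigma v a.

Lemma phi_local u v j :
  sigma u j = sigma v j -> sigma u j.+1 = sigma v j.+1 -> phi u j = phi v j.
Proof.
move=> e0 e1; apply/eqP; rewrite eq_sym phiE -phi_funP -e0 -e1 phi_funP.
by rewrite phiE.
Qed.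

End PartialProducts.

(** * Moves and the exchange of labels *)

Section Moves.
Variable n : nat.
Implicit Types (w u v : F n) (i : 'I_n.-2).

Lemma ltn_lo i : i < n.-1.
Proof. exact: (ltn_ord (lo i)). Qed.

Lemma ltn_hi i : i.+1 < n.-1.
Proof. by rewrite -val_hi. Qed.

Lemma agree_trans a u v w : agree_off a u v -> agree_off a v w -> agree_off a u w.
Proof. by move=> h1 h2 b ba; rewrite h1 ?h2. Qed.

Lemma agree_eq a u v : agree_off a u v -> sigma u a = sigma v a -> u = v.
Proof. by move=> h h'; apply: F_ext => b; have [->|/h] := eqVneq b a. Qed.

Lemma agree_replace2 u v i :
  (forall a, a != i :> nat -> a != i.+1 -> letter u a = letter v a) ->
  pmul (letter u i) (letter u i.+1) = pmul (letter v i) (letter v i.+1) ->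
  agree_off i.+1 u v.
Proof.
move=> eL eP.
have up a : i.+1 < a -> sigma u a = sigma v a.
  have [d] := ubnP (n.-1 - a); elim: d a => // d IH a ad ia.
  have [na|an] := leqP n.-1 a; first by rewrite !sigma_over.
  rewrite (sigmaS u an) (sigmaS v an) IH ?eL //; lia.
have mid : sigma u i = sigma v i.
  rewrite (sigmaS u (ltn_lo i)) (sigmaS v (ltn_lo i)).
  rewrite (sigmaS u (ltn_hi i)) (sigmaS v (ltn_hi i)) up //.
  by move: eP; rewrite /pmul -!mulgA => ->.
move=> a ai; case: (ltnP i.+1 a) => [/up//|ai1].
have {ai ai1} : a <= i by lia.
have [d] := ubnP (i - a); elim: d a => // d IH a ad; rewrite leq_eqVlt.
case/predU1P=> [->//|ai]; have an := ltn_trans ai (ltn_lo i).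
rewrite (sigmaS u an) (sigmaS v an) IH ?eL //; lia.
Qed.

Lemma letter_replace2 (x : (n.-1).-tuple 'S_n) (a : nat) (s t : 'S_n) k : k < n.-1 ->
  letter (replace2 x a s t) k =
  if k == a then s else if k == a.+1 then t else letter x k.
Proof.
move=> kn; rewrite /letter -[k in LHS]/(val (Ordinal kn)) -tnth_nth.
by rewrite tnth_mktuple.
Qed.

Lemma letter_over w a : n.-1 <= a -> letter w a = 1%g.
Proof. by move=> na; rewrite /letter nth_default ?size_tuple. Qed.

Lemma letterV w a : (letter w a)^-1%g = letter w a.
Proof.
have [na|an] := leqP n.-1 a; first by rewrite letter_over // invg1.
have /existsP[x /existsP[y /andP[_ /eqP->]]] := is_transp_letter w an.
by rewrite tpermV.
Qed.

Lemma letterRl i w : letter (Rmove i w) i = pconj (letter w i.+1) (letter w i).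
Proof. by rewrite letter_replace2 ?ltn_lo // eqxx. Qed.
Lemma letterRr i w : letter (Rmove i w) i.+1 = letter w i.
Proof. by rewrite letter_replace2 ?ltn_hi // eqxx gtn_eqF. Qed.
Lemma letterLl i w : letter (Lmove i w) i = letter w i.+1.
Proof. by rewrite letter_replace2 ?ltn_lo // eqxx. Qed.
Lemma letterLr i w : letter (Lmove i w) i.+1 = pconj (letter w i) (letter w i.+1).
Proof. by rewrite letter_replace2 ?ltn_hi // eqxx gtn_eqF. Qed.

Lemma agree_R i w : agree_off i.+1 (Rmove i w) w.
Proof.
apply: agree_replace2 => [a /negPf ai /negPf ai1|].
  have [na|an] := leqP n.-1 a; first by rewrite !letter_over.
  by rewrite letter_replace2 // ai ai1.
by rewrite letterRl letterRr /pmul /pconj /pmul letterV !mulgA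
           -{1}(letterV w i) mulVg mul1g.
Qed.

Lemma agree_L i w : agree_off i.+1 (Lmove i w) w.
Proof.
apply: agree_replace2 => [a /negPf ai /negPf ai1|].
  have [na|an] := leqP n.-1 a; first by rewrite !letter_over.
  by rewrite letter_replace2 // ai ai1.
by rewrite letterLl letterLr /pmul /pconj /pmul -!mulgA mulVg mulg1.
Qed.

Arguments agree_R : clear implicits.
Arguments agree_L : clear implicits.

Lemma sigma_R i w : sigma (Rmove i w) i.+1 = pmul (letter w i) (sigma w i.+2).
Proof.
by rewrite (sigmaS _ (ltn_hi i)) letterRr (agree_R i w) // gtn_eqF.
Qed.

Lemma sigma_L i w : sigma (Lmove i w) i.+1 = pmul (letter w i.+1) (sigma w i).
Proof.
have := agree_L i w i; rewrite ltn_eqF // => /(_ isT) <-.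
rewrite (sigmaS (Lmove i w) (ltn_lo i)) letterLl.
by rewrite /pmul -mulgA -{1}(letterV w i.+1) mulVg mulg1.
Qed.

Lemma RL i w : Rmove i (Lmove i w) = w.
Proof.
apply: (@agree_eq i.+1); first exact: agree_trans (agree_R _ _) (agree_L _ _).
rewrite sigma_R letterLl (agree_L i w) ?gtn_eqF //.
by rewrite -(sigmaS w (ltn_hi i)).
Qed.

Lemma LR i w : Lmove i (Rmove i w) = w.
Proof.
apply: (@agree_eq i.+1); first exact: agree_trans (agree_L _ _) (agree_R _ _).
rewrite sigma_L letterRr (agree_R i w) ?ltn_eqF //.
rewrite (sigmaS w (ltn_lo i)) /pmul -mulgA -{1}(letterV w i) mulVg mulg1 //.
Qed.

Lemma hurwitz_sym u v : hurwitz u v -> hurwitz v u.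
Proof.
rewrite /hurwitz eq_sym => /andP[-> /existsP[i /orP[]/eqP->]] /=;
  apply/existsP; exists i.
  by rewrite LR eqxx orbT.
by rewrite RL eqxx.
Qed.

Lemma hurwitz_agree u v : hurwitz u v -> exists i, agree_off i.+1 v u.
Proof.
case/andP=> _ /existsP[i /orP[]/eqP->]; exists i; [exact: agree_R|exact: agree_L].
Qed.

(** Write [p] for the label of step [i]. If step [i.+1] does not move [p], the
    transposition of step [i] can be performed first, and it still raises [p]:
    this is the move R. Otherwise step [i.+1] lowers [p]; then the final value of
    [p] is not touched by the transposition of step [i.+1], so that undoing the
    latter after both steps, which is the move L, leaves [p] raised. *)
Lemma swap_labels i w : exists2 v, v = Rmove i w \/ v = Lmove i w &
  phi v (hi i) = phi w (lo i).
Proof.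
have hE : hi i = i.+1 :> nat := val_hi i.
have first_up v : agree_off i.+1 v w ->
    sigma w i.+2 (lo (phi w (lo i))) < sigma v i.+1 (lo (phi w (lo i))) ->
    phi v (hi i) = phi w (lo i).
  move=> ag lt; apply/eqP; rewrite phiE -phi_funP hE.
  by rewrite (ag i.+2) ?gtn_eqF.
have npq : phi w (lo i) != phi w (hi i).
  rewrite (inj_eq perm_inj); apply/eqP => /(congr1 (@nat_of_ord _)).
  by rewrite hE => /n_Sn.
have s_i x : sigma w i x = letter w i (sigma w i.+1 x).
  by rewrite (sigmaS w (ltn_lo i)) pmulE.
have s_i1 x : sigma w i.+1 x = letter w i.+1 (sigma w i.+2 x).
  by rewrite (sigmaS w (ltn_hi i)) pmulE.
set p := phi w (lo i) in first_up npq *; set q := phi w (hi i) in npq *.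
have eTi : letter w i = tperm (sigma w i.+1 (lo p)) (sigma w i (lo p)).
  by have [] := sigma_step w (lo i).
have eTi1 : letter w i.+1 = tperm (sigma w i.+2 (lo q)) (sigma w i.+1 (lo q)).
  by have [] := sigma_step w (hi i); rewrite hE.
have p0 : p < sigma w i (lo p) by rewrite exceedance.
have p1 : ~~ (p < sigma w i.+1 (lo p)) by rewrite exceedance ltnn.
have p2 : ~~ (p < sigma w i.+2 (lo p)) by rewrite exceedance -ltnNge leqnSn.
have q0 : q < sigma w i (lo q) by rewrite exceedance hE.
have q2 : ~~ (q < sigma w i.+2 (lo q)) by rewrite exceedance hE -ltnNge.
have up_p y : ~~ (p < sigma w i.+2 y) -> sigma w i.+2 y < sigma w i (lo p).
  by rewrite -leqNgt => h; apply: leq_ltn_trans h p0.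
have [fixp|movep] := eqVneq (sigma w i.+1 (lo p)) (sigma w i.+2 (lo p)).
  exists (Rmove i w); first by left.
  apply: first_up; first exact: agree_R.
  by rewrite sigma_R pmulE -fixp -s_i fixp up_p.
(* Step [i.+1] exchanges the values of [p] and [q]. *)
have [e1 e2] : sigma w i.+2 (lo p) = sigma w i.+1 (lo q) /\
               sigma w i.+1 (lo p) = sigma w i.+2 (lo q).
  move: movep; rewrite s_i1 eTi1; case: tpermP => [/perm_inj/lo_inj epq|->//|_ _];
    last by rewrite eqxx.
  by rewrite epq eqxx in npq.
exists (Lmove i w); first by right.
apply: first_up; first exact: agree_L.
rewrite sigma_L pmulE eTi1 tpermD ?up_p //.
  apply: contraTneq p0 => <-; rewrite -e2; exact: p1.
apply: contraNneq q2 => eqq; rewrite -e2.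
by move: q0; rewrite s_i eTi eqq tpermR.
Qed.

(** The labels away from the modified product are determined by unchanged
    products; the two others are then kept or exchanged, as labels are distinct. *)
Lemma phi_agree i u v : agree_off i.+1 v u ->
  phi v = phi u \/ phi v = (tperm (lo i) (hi i) * phi u)%g.
Proof.
move=> ag; have far j : j != lo i -> j != hi i -> phi v j = phi u j.
  rewrite -!(inj_eq (@ord_inj _)) val_hi /= => ji ji1.
  by apply: phi_local; apply: ag.
have near j : (j == lo i) || (j == hi i) ->
    phi v j = phi u (lo i) \/ phi v j = phi u (hi i).
  move=> jn; have [k ek] := phi_onto u (phi v j).
  have [k0|k0] := eqVneq k (lo i); first by left; rewrite -k0.
  have [k1|k1] := eqVneq k (hi i); first by right; rewrite -k1.
  move: ek jn; rewrite -(far _ k0 k1) => /perm_inj->.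
  by rewrite (negPf k0) (negPf k1).
have nlh : lo i != hi i.
  by rewrite -(inj_eq (@ord_inj _)) val_hi; apply/eqP/n_Sn.
have nphi : phi v (lo i) <> phi v (hi i).
  by move/perm_inj/eqP; rewrite (negPf nlh).
have nl := near (lo i); rewrite eqxx in nl.
have nh := near (hi i); rewrite eqxx orbT in nh.
have [[l|l] [h|h]] := (nl isT, nh isT); [by case: nphi; rewrite l h| | |by case: nphi; rewrite l h].
  left; apply/permP => j; have [->//|j0] := eqVneq j (lo i).
  by have [->//|j1] := eqVneq j (hi i); apply: far.
right; apply/permP => j; rewrite permM; case: tpermP => [->//|->//|/eqP j0 /eqP j1].
exact: far.
Qed.

End Moves.

(** * Inversions *)

Section Inversions.
Variable m : nat.
Implicit Types (s t : 'S_m) (i : 'I_m.-1).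

Definition inv s : nat :=
  #|[set x : 'I_m * 'I_m | (x.1 < x.2) && (s x.2 < s x.1)]|.

Definition adj i : 'S_m := tperm (lo i) (hi i).

Lemma ltn_lo_hi i : lo i < hi i.
Proof. by rewrite val_hi. Qed.

Lemma adj_mono i (x y : 'I_m) : x < y -> (x, y) != (lo i, hi i) -> adj i x < adj i y.
Proof.
rewrite /adj xpair_eqE => xy.
have hE := val_hi i; have lE : lo i = i :> nat by [].
case: tpermP => [ex|ex|/eqP + /eqP +]; case: tpermP => [ey|ey|/eqP + /eqP +];
  move: xy; rewrite -?(inj_eq (@ord_inj _)) ?ex ?ey ?hE ?lE negb_and; lia.
Qed.

(** Multiplication by an adjacent transposition permutes the pairs of positions,
    and preserves the order inside each pair except the transposed one. *)
Lemma inv_swap s i : s (lo i) < s (hi i) -> inv (adj i * s)%g = (inv s).+1.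
Proof.
move=> asc; rewrite /inv.
set A := [set x | _] ; set B := [set x | _].
pose f (x : 'I_m * 'I_m) := (adj i x.1, adj i x.2).
have fK : involutive f by case=> x y; rewrite /f /= !tpermK.
have fi : f (lo i, hi i) = (hi i, lo i) by rewrite /f /= /adj tpermL tpermR.
have -> : A = (lo i, hi i) |: f @: B.
  apply/setP => -[x y]; rewrite in_setU1 -{3}(fK (x, y)) mem_imset; last exact: inv_inj fK.
  rewrite !inE /= !permM.
  have [[-> ->]|xy] := eqVneq (x, y) (lo i, hi i).
    by rewrite /= /adj tpermL tpermR asc ltn_lo_hi.
  case: ltngtP => [lt|gt|/ord_inj ->] /=; last by rewrite ltnn.
    by rewrite (adj_mono lt).
  symmetry; apply: contraNF (xy) => /andP[lt lts].
  have [[ey ex]|yx] := eqVneq (y, x) (lo i, hi i).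
    by move: lts; rewrite ex ey /adj tpermL tpermR ltnNge ltnW.
  by have := ltn_trans lt (adj_mono gt yx); rewrite ltnn.
rewrite cardsU1 card_imset; last exact: inv_inj fK.
rewrite (_ : _ \notin _) //; apply/negP => /imsetP[x xB /(congr1 f)].
rewrite fK fi => ex; move: xB; rewrite -ex inE /=.
by rewrite ltnNge ltnW // ltn_lo_hi.
Qed.

Lemma inv_swap_desc s i : s (hi i) < s (lo i) -> inv s = (inv (adj i * s)%g).+1.
Proof.
move=> desc; rewrite -(inv_swap (i := i)); first by rewrite mulgA tperm2 mul1g.
by rewrite !permM tpermL tpermR.
Qed.

Lemma asc_or_desc s i : s (lo i) < s (hi i) \/ s (hi i) < s (lo i).
Proof.
case: (ltngtP (s (lo i)) (s (hi i))) => [|//|/ord_inj/perm_inj e]; [by left|by right|].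
by have := ltn_lo_hi i; rewrite e ltnn.
Qed.

Lemma mono_adj (f : 'I_m -> nat) : (forall i, f (lo i) < f (hi i)) ->
  forall j k : 'I_m, j < k -> f j < f k.
Proof.
move=> asc j k jk; have [d dk] : exists d, k = j + d.+1 :> nat.
  by exists (k - j.+1); lia.
elim: d k dk {jk} => [|d IH] k dk.
  have jm : j < m.-1 by have := ltn_ord k; lia.
  have := asc (Ordinal jm); congr (_ < _); congr f; apply: ord_inj => //.
  by rewrite val_hi dk addn1.
have km : j + d.+1 < m.-1 by have := ltn_ord k; lia.
apply: leq_trans (_ : f (lo (Ordinal km)) < _); first by rewrite ltnS ltnW // IH.
have -> : k = hi (Ordinal km) by apply: ord_inj; rewrite val_hi dk /= addnS.
exact: asc.
Qed.

(** An increasing permutation satisfies [j <= s j], and so does its inverse. *)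
Lemma increasing1 s : (forall j k : 'I_m, j < k -> s j < s k) -> s = 1%g.
Proof.
have ge t : (forall j k : 'I_m, j < k -> t j < t k) -> forall j : 'I_m, j <= t j.
  move=> asc [j jm]; elim: j jm => // j IH jm.
  by apply: leq_ltn_trans (IH (ltnW jm)) _; apply: asc.
move=> asc; have ascV (j k : 'I_m) : j < k -> (s^-1)%g j < (s^-1)%g k.
  move=> jk; rewrite ltnNge leq_eqVlt; apply/norP; split.
    by apply/eqP => /ord_inj/perm_inj e; rewrite e ltnn in jk.
  by apply/negP => /asc; rewrite !permKV ltnNge ltnW.
apply/permP => j; apply/ord_inj/eqP; rewrite perm1 eqn_leq ge // andbT.
by have := ge _ ascV (s j); rewrite permK.
Qed.

Lemma reversal_unique s t :
  (forall i, s (hi i) < s (lo i)) -> (forall i, t (hi i) < t (lo i)) -> s = t.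
Proof.
have desc (r : 'S_m) : (forall i, r (hi i) < r (lo i)) -> forall j k : 'I_m, j < k -> r k < r j.
  (* Subtracting from [m] turns descents into ascents. *)
  move=> d j k jk; have := @mono_adj (fun x => m - r x) _ j k jk.
  have := ltn_ord (r j); have := ltn_ord (r k).
  have asc i : m - r (lo i) < m - r (hi i).
    by have := d i; have := ltn_ord (r (lo i)); lia.
  by move=> ? ? /(_ asc); lia.
move=> /desc ds /desc dt; apply: (mulgI s^-1%g); rewrite mulVg; apply/esym.
apply: increasing1 => j k jk; rewrite !permM; apply: dt.
rewrite ltnNge leq_eqVlt; apply/norP; split.
  by apply/eqP => /ord_inj/perm_inj e; rewrite e ltnn in jk.
by apply/negP => /ds; rewrite !permKV ltnNge ltnW.
Qed.

End Inversions.

(** * Distance from [e] and the down operators *)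

Section Distance.
Variable n : nat.
Implicit Types (w u v : F n) (i : 'I_n.-2) (p : seq (F n)).

Definition len w : nat := inv (phi w).

Lemma len_step u v : hurwitz u v -> len v <= (len u).+1.
Proof.
move=> /hurwitz_agree[i /phi_agree[]]; rewrite /len => ->; first exact: leqnSn.
have [asc|desc] := asc_or_desc (phi u) i; first by rewrite inv_swap.
by rewrite (inv_swap_desc desc) !leqW.
Qed.

Lemma len_path u p : path (@hurwitz n) u p -> len (last u p) <= len u + size p.
Proof.
elim: p u => [|v p IH] u /=; first by rewrite addn0.
case/andP=> /len_step uv /IH vp; apply: leq_trans vp _.
by rewrite addnS -addSn leq_add2r.
Qed.

Lemma phi_e : phi (e n) = 1%g.
Proof.
have le (j : 'I_n.-1) : letter (e n) j = tperm (lo j) (hi j).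
  by rewrite /letter -tnth_nth tnth_mktuple.
have below (x : 'I_n) a : x < a -> sigma (e n) a x = x.
  have [d] := ubnP (n.-1 - a); elim: d a => // d IH a ad xa.
  have [na|an] := leqP n.-1 a; first by rewrite sigma_over // perm1.
  rewrite (sigmaS (e n) an) pmulE (IH a.+1) //; [|lia|lia].
  rewrite (le (Ordinal an)) tpermD // -(inj_eq (@ord_inj _)) ?val_hi /=; lia.
apply/permP => j; rewrite perm1 phiE; apply/eqP; rewrite -phi_funP.
rewrite (sigmaS (e n) (ltn_ord j)) pmulE below // le tpermL; exact: ltn_lo_hi.
Qed.

Lemma len_e : len (e n) = 0.
Proof.
rewrite /len phi_e; apply/eqP; rewrite cards_eq0 -subset0.
by apply/subsetP => x; rewrite !inE !perm1; case: ltngtP.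
Qed.

(** The whole range is a segment between the cycle and the identity. *)
Lemma all_asc_e w : (forall i, phi w (lo i) < phi w (hi i)) -> w = e n.
Proof.
move=> asc; apply: F_ext => a; have [na|an] := leqP n.-1 a.
  by rewrite !sigma_over.
apply: (@segment_unique n w (e n) 0 n.-1); rewrite ?sigma0 ?sigma_over ?(ltnW an) //.
  by move=> j k _ jk _; apply: (@mono_adj _ (fun x => phi w x)).
by move=> j k _ jk _; rewrite phi_e !perm1.
Qed.

Lemma adj_neighbor i w : exists v,
  [/\ v = Rmove i w \/ v = Lmove i w, agree_off i.+1 v w &
      phi v = (adj i * phi w)%g].
Proof.
have [v vRL lab] := swap_labels i w; exists v.
have ag : agree_off i.+1 v w by case: vRL => ->; [apply: agree_R|apply: agree_L].
split=> //; case: (phi_agree ag) => // e; have := lab; rewrite e => /perm_inj e'.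
by have := ltn_lo_hi i; rewrite e' ltnn.
Qed.

Lemma hurwitz_RL i u w : u = Rmove i w \/ u = Lmove i w -> u != w -> hurwitz w u.
Proof.
move=> uRL uw; rewrite /hurwitz eq_sym uw /=; apply/existsP; exists i.
by case: uRL => ->; rewrite eqxx ?orbT.
Qed.

Lemma adj_phi_neq i w u : phi u = (adj i * phi w)%g -> u != w.
Proof.
move=> e; apply/eqP => uw; move: e; rewrite uw => /permP/(_ (lo i)).
rewrite permM /adj tpermL => /perm_inj e.
by have := ltn_lo_hi i; rewrite -e ltnn.
Qed.

Lemma down_path w : exists p,
  [/\ path (@hurwitz n) (e n) p, last (e n) p = w & size p = len w].
Proof.
have [l] := ubnP (len w); elim: l w => // l IH w wl.
have [asc|] := pselect (forall i, phi w (lo i) < phi w (hi i)).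
  rewrite (all_asc_e asc); by exists [::]; split=> //; rewrite len_e.
move=> nasc; have [i desc] : exists i, phi w (hi i) < phi w (lo i).
  apply: contrapT => no; apply: nasc => i.
  by have [//|d] := asc_or_desc (phi w) i; case: no; exists i.
have [v [vRL _ ev]] := adj_neighbor i w.
have lv : len w = (len v).+1 by rewrite /len ev -inv_swap_desc.
have [|p [pp lp sp]] := IH v; first by rewrite -ltnS -lv.
exists (rcons p w); rewrite rcons_path last_rcons size_rcons lp sp lv pp.
by split=> //=; apply: hurwitz_sym; apply: hurwitz_RL vRL (adj_phi_neq ev).
Qed.

Lemma len_path_e p : path (@hurwitz n) (e n) p -> len (last (e n) p) <= size p.
Proof. by move=> /len_path; rewrite len_e. Qed.

(** Distance from [e] is the number of inversions: a move changes it by at most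
    one, and a chain without descent is [e]. *)
Lemma geodesicP w p : geodesic (e n) w p <->
  [/\ path (@hurwitz n) (e n) p, last (e n) p = w & size p = len w].
Proof.
split=> [[pp lp min]|[pp lp sp]]; split=> //.
  have [q [qp lq sq]] := down_path w.
  by apply/eqP; rewrite eqn_leq -{1}sq min // -lp len_path_e.
by move=> q qp lq; rewrite sp -lq len_path_e.
Qed.

(** A geodesic to [w] through [v] can be rerouted before [v] along a geodesic
    through [u]. *)
Lemma weak_le_trans u v w : weak_le u v -> weak_le v w -> weak_le u w.
Proof.
case=> p /geodesicP[pp lp sp] up [q /geodesicP[]] + + + vq.
case/splitPl: vq => q1 q2 l1; rewrite cat_path last_cat size_cat l1.
case/andP=> q1p q2p lq sq; exists (p ++ q2); last by rewrite -cat_cons mem_cat up.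
apply/geodesicP; rewrite cat_path last_cat size_cat lp pp q2p lq sp; split=> //.
apply/eqP; rewrite eqn_leq -{1}sq leq_add2r -{1}l1 len_path_e //=.
rewrite -{1}lq; have := len_path q2p; lia.
Qed.

Lemma weak_cover v w : hurwitz v w -> len w = (len v).+1 -> weak_le v w.
Proof.
move=> vw lw; have [p [pp lp sp]] := down_path v.
exists (rcons p w); first apply/geodesicP.
  by rewrite rcons_path last_rcons size_rcons lp pp sp lw.
by rewrite -rcons_cons mem_rcons inE -lp mem_last orbT.
Qed.

Lemma weak_lt_len v w : weak_lt v w -> len v < len w.
Proof.
case=> -[p /geodesicP[]] + + + vp vw.
case/splitPl: vp => q1 q2 l1; rewrite cat_path last_cat size_cat l1.
case/andP=> q1p q2p lq sq; have := len_path_e q1p; rewrite -sq l1 => le1.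
by case: q2 lq {q2p sq} => [//|x q2] _ /=; lia.
Qed.

(** A move going down in the weak order loses inversions, so it does exchange
    the two labels; and a move exchanging them at a descent goes down. *)
Lemma down_desc i w : phi w (hi i) < phi w (lo i) ->
  [/\ agree_off i.+1 (down i w) w, phi (down i w) = (adj i * phi w)%g &
      weak_le (down i w) w].
Proof.
move=> desc; have low v : v = Rmove i w \/ v = Lmove i w -> weak_lt v w ->
    [/\ agree_off i.+1 v w, phi v = (adj i * phi w)%g & weak_le v w].
  move=> vRL lt; have ag : agree_off i.+1 v w.
    by case: vRL => ->; [apply: agree_R|apply: agree_L].
  split=> //; last by case: lt.
  case: (phi_agree ag) => // e; have := weak_lt_len lt.
  by rewrite /len e ltnn.
rewrite /down inE desc; case: asboolP => [lt|nR]; first by apply: low => //; left.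
case: asboolP => [lt|nL]; first by apply: low => //; right.
have [v [vRL _ ev]] := adj_neighbor i w.
have lt : weak_lt v w.
  split; last exact/eqP/(adj_phi_neq ev).
  apply: weak_cover; last by rewrite /len ev -inv_swap_desc.
  by apply: hurwitz_sym; apply: hurwitz_RL vRL (adj_phi_neq ev).
by case: vRL => e; rewrite e in lt.
Qed.

Lemma down_asc i w : phi w (lo i) < phi w (hi i) -> down i w = w.
Proof. by move=> asc; rewrite /down inE ltnNge ltnW. Qed.

Lemma weak_le_refl w : weak_le w w.
Proof.
have [p hp] := down_path w; exists p; first exact/geodesicP.
by case: hp => _ <- _; apply: mem_last.
Qed.

Lemma down_le i w : weak_le (down i w) w.
Proof.
have [/down_asc->|/down_desc[] //] := asc_or_desc (phi w) i.
exact: weak_le_refl.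
Qed.

End Distance.

(** * The relations between the down operators *)

Section DownRelations.
Variable n : nat.
Implicit Types (w u v : F n) (i j : 'I_n.-2).

Lemma agree_down i w : agree_off i.+1 (down i w) w.
Proof.
by have [/down_asc->|/down_desc[]] := asc_or_desc (phi w) i.
Qed.

Lemma asc_down i w : phi (down i w) (lo i) < phi (down i w) (hi i).
Proof.
have [asc|desc] := asc_or_desc (phi w) i; first by rewrite down_asc.
by have [_ -> _] := down_desc desc; rewrite !permM /adj tpermL tpermR.
Qed.

Lemma phi_down_far i w (k : 'I_n.-1) : k != i :> nat -> k != i.+1 :> nat ->
  phi (down i w) k = phi w k.
Proof.
by move=> k0 k1; apply: phi_local; apply: agree_down.
Qed.

Lemma phi_down_lo i w :
  phi (down i w) (lo i) = minn (phi w (lo i)) (phi w (hi i)) :> nat.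
Proof.
have [asc|desc] := asc_or_desc (phi w) i; first by rewrite down_asc //; lia.
have [_ -> _] := down_desc desc; rewrite permM /adj tpermL; lia.
Qed.

Lemma phi_down_hi i w :
  phi (down i w) (hi i) = maxn (phi w (lo i)) (phi w (hi i)) :> nat.
Proof.
have [asc|desc] := asc_or_desc (phi w) i; first by rewrite down_asc //; lia.
have [_ -> _] := down_desc desc; rewrite permM /adj tpermR; lia.
Qed.

Lemma down_idem i w : down i (down i w) = down i w.
Proof. by rewrite down_asc ?asc_down. Qed.

(** The segment around [i.+1] has the same ends in both products and increasing
    labels, hence the same middle; likewise around [j.+1]. *)
Lemma down_comm i j w : i.+1 < j -> down i (down j w) = down j (down i w).
Proof.
move=> ij; set x := down i _; set y := down j _.
have offx a : a != i.+1 -> a != j.+1 -> sigma x a = sigma w a.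
  by move=> ai aj; rewrite agree_down // agree_down.
have offy a : a != i.+1 -> a != j.+1 -> sigma y a = sigma w a.
  by move=> ai aj; rewrite agree_down // agree_down.
have lE (k : 'I_n.-2) : lo k = k :> nat by [].
have mid (k : 'I_n.-2) : (k == i) || (k == j) -> sigma x k.+1 = sigma y k.+1.
  move=> kij; have {}kij : (k == i :> nat) || (k == j :> nat) by [].
  have ax : phi x (lo k) < phi x (hi k).
    case/orP: kij => /eqP/ord_inj->; first exact: asc_down.
    rewrite (@phi_down_far i (down j w) (lo j)) ?(@phi_down_far i (down j w) (hi j)) ?val_hi ?lE; try lia.
    exact: asc_down.
  have ay : phi y (lo k) < phi y (hi k).
    case/orP: kij => /eqP/ord_inj->; last exact: asc_down.
    rewrite (@phi_down_far j (down i w) (lo i)) ?(@phi_down_far j (down i w) (hi i)) ?val_hi ?lE; try lia.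
    exact: asc_down.
  have asc u : phi u (lo k) < phi u (hi k) ->
      forall a b : 'I_n.-1, k <= a -> a < b -> b < k.+2 -> phi u a < phi u b.
    move=> lt a b ka ab bk.
    have -> : a = lo k by apply: ord_inj; rewrite lE; lia.
    by have -> : b = hi k by apply: ord_inj; rewrite val_hi; lia.
  apply: (segment_unique (ltn_hi k) _ _ _ (asc _ ax) (asc _ ay)); rewrite ?offx ?offy //; lia.
apply: F_ext => a; have [->|ai] := eqVneq a i.+1; first by rewrite mid ?eqxx.
have [->|aj] := eqVneq a j.+1; first by rewrite mid ?eqxx ?orbT.
by rewrite offx ?offy.
Qed.

(** The down operators act on these triples as sorting operators. *)
Definition labels3 i j w : nat * nat * nat :=
  (phi w (lo i) : nat, phi w (hi i) : nat, phi w (hi j) : nat).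

(** Both sides sort the three labels at [i], [i.+1], [i.+2] and keep the partial
    products outside this segment, so they agree by [segment_unique]. *)
Lemma down_braid i j w : j = i.+1 :> nat ->
  down i (down j (down i w)) = down j (down i (down j w)).
Proof.
move=> ji; set x := down i _; set y := down j _.
have offx a : a != i.+1 -> a != i.+2 -> sigma x a = sigma w a.
  by move=> ai aj; rewrite !agree_down ?ji.
have offy a : a != i.+1 -> a != i.+2 -> sigma y a = sigma w a.
  by move=> ai aj; rewrite !agree_down ?ji.
have lj : lo j = hi i by apply: ord_inj; rewrite val_hi -ji.
have sort_i u : labels3 i j (down i u) =
    let: (a, b, c) := labels3 i j u in (minn a b, maxn a b, c).
  rewrite /labels3 phi_down_lo phi_down_hi (@phi_down_far i u (hi j)) // val_hi ji; lia.
have sort_j u : labels3 i j (down j u) =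
    let: (a, b, c) := labels3 i j u in (a, minn b c, maxn b c).
  rewrite /labels3 phi_down_hi (@phi_down_far j u (lo i)) ?ji /=; try lia.
  by rewrite -lj phi_down_lo.
have neq01 u : phi u (lo i) != phi u (hi i) :> nat.
  by rewrite (inj_eq (@ord_inj _)) (inj_eq perm_inj) -(inj_eq (@ord_inj _)) val_hi /=; lia.
have neq12 u : phi u (hi i) != phi u (hi j) :> nat.
  rewrite (inj_eq (@ord_inj _)) (inj_eq perm_inj).
  by rewrite -(inj_eq (@ord_inj _)) !val_hi ji; lia.
have ax1 : phi x (hi i) < phi x (hi j).
  have := sort_i (down j (down i w)).
  rewrite (sort_j (down i w)) (sort_i w) /labels3 => -[_ bx cx].
  by have := neq12 x; rewrite bx cx; lia.
have ay0 : phi y (lo i) < phi y (hi i).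
  have := sort_j (down i (down j w)).
  rewrite (sort_i (down j w)) (sort_j w) /labels3 => -[a_y b_y _].
  by have := neq01 y; rewrite a_y b_y; lia.
have ax0 : phi x (lo i) < phi x (hi i) := asc_down _ _.
have ay1 : phi y (hi i) < phi y (hi j) by rewrite -lj asc_down.
have asc u : phi u (lo i) < phi u (hi i) -> phi u (hi i) < phi u (hi j) ->
    forall a b : 'I_n.-1, i <= a -> a < b -> b < i.+3 -> phi u a < phi u b.
  move=> lt0 lt1 a b ia ab bi.
  have [ea|[ea|ea]] : a = i :> nat \/ a = i.+1 :> nat \/ a = i.+2 :> nat by lia.
  - have -> : a = lo i by apply: ord_inj.
    have [eb|eb] : b = i.+1 :> nat \/ b = i.+2 :> nat by lia.
      by have -> : b = hi i by apply: ord_inj; rewrite val_hi.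
    have -> : b = hi j by apply: ord_inj; rewrite val_hi ji.
    exact: ltn_trans lt0 lt1.
  - have -> : a = hi i by apply: ord_inj; rewrite val_hi.
    by have -> : b = hi j by apply: ord_inj; rewrite val_hi ji; lia.
  - lia.
have i3 : i.+3 <= n.-1 by have := ltn_hi j; rewrite ji.
have seg := segment_unique i3 _ _ _ (asc _ ax0 ax1) (asc _ ay0 ay1).
apply: F_ext => a; have [/andP[ia ai]|out] := boolP ((i <= a) && (a <= i.+3)).
  by apply: seg; rewrite ?offx ?offy //; lia.
by rewrite offx ?offy //; lia.
Qed.

End DownRelations.

Local Open Scope ring_scope.
Import GRing.Theory.

(** * Normal forms of words in idempotent braid generators *)

Section NormalForms.
Variables (A : nzRingType) (T : nat -> A).
Hypothesis T_idem : forall i, T i * T i = T i.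
Hypothesis T_comm : forall i j, (i.+1 < j)%N -> T i * T j = T j * T i.
Hypothesis T_braid : forall i, T i * T i.+1 * T i = T i.+1 * T i * T i.+1.

(** [T (k.-1) * T (k.-2) * ... * T (k - d)]. *)
Fixpoint tail_word (k d : nat) : A :=
  if d is d'.+1 then tail_word k d' * T (k - d'.+1) else 1.

(** The reduced words of the permutations of [k.+1] letters, along the chain of
    parabolic subgroups: a permutation is one of [k] letters times a minimal coset
    representative. *)
Fixpoint normal_forms (k : nat) : seq A :=
  if k is k'.+1 then
    [seq x * tail_word k d | x <- normal_forms k', d <- iota 0 k.+1]
  else [:: 1].

Lemma size_normal_forms k : size (normal_forms k) = (k.+1)`!.
Proof.
by elim: k => [//|k IH]; rewrite size_allpairs size_iota IH mulnC -factS.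
Qed.

Lemma normal_formSP k x : reflect
  (exists y d, [/\ y \in normal_forms k, (d <= k.+1)%N & x = y * tail_word k.+1 d])
  (x \in normal_forms k.+1).
Proof.
apply: (iffP allpairsP) => [[[y d] [yk]]|[y [d [yk dk ->]]]].
  by rewrite mem_iota => dk ->; exists y, d.
by exists (y, d); split=> //; rewrite mem_iota.
Qed.

Lemma one_normal_form k : 1 \in normal_forms k.
Proof.
elim: k => [|k IH]; first exact: mem_head.
by apply/normal_formSP; exists 1, 0%N; rewrite IH mulr1.
Qed.

Lemma tail_comm k d i : (d <= k)%N -> (i.+1 < k - d)%N ->
  tail_word k d * T i = T i * tail_word k d.
Proof.
elim: d => [|d IH] dk ikd; first by rewrite mul1r mulr1.
by rewrite /= -mulrA -T_comm; [rewrite !mulrA IH //; lia|lia].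
Qed.

(** The braid relation moves a generator through a descending product, lowering
    its index by one. *)
Lemma tail_shift k d i : (d <= k)%N -> (i < k)%N -> (k - d < i)%N ->
  tail_word k d * T i = T i.-1 * tail_word k d.
Proof.
elim: d => [|d IH] dk ik kdi; first by lia.
have [far|near] := ltnP (k - d) i.
  rewrite /= -mulrA T_comm; last lia.
  by rewrite !mulrA IH //; lia.
have eqi : i = (k - d.+1).+1 by lia.
have [d' ed] : exists d', d = d'.+1 by case: (d) kdi ik near => [|d']; [lia|exists d'].
rewrite ed /= in dk eqi *; have -> : (k - d'.+1)%N = i by lia.
have -> : (k - d'.+2)%N = i.-1 by lia.
set j := i.-1; have -> : i = j.+1 by rewrite /j; lia.
rewrite -!mulrA (mulrA (T j.+1)) -T_braid !mulrA tail_comm //; rewrite /j; lia.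
Qed.

(** A generator is absorbed by the descending factor [tail_word], or extends it,
    or crosses it and becomes a generator of index less than [k.-1]. *)
Lemma normal_form_mul k i x :
  (i < k)%N -> x \in normal_forms k -> x * T i \in normal_forms k.
Proof.
elim: k x i => // k IH x i ik /normal_formSP[y [d [yk dk ->]]].
have in_nf z d' : z \in normal_forms k -> (d' <= k.+1)%N ->
    z * tail_word k.+1 d' \in normal_forms k.+1.
  by move=> zk d'k; apply/normal_formSP; exists z, d'.
case: (ltngtP i (k.+1 - d)) => cmp; last 1 first.
- have [d' ed] : exists d', d = d'.+1 by case: (d) cmp => [|d']; [lia|exists d'].
  have -> : T i = T (k.+1 - d'.+1)%N by rewrite cmp ed.
  by rewrite -mulrA ed /= -mulrA T_idem -/(tail_word k.+1 d'.+1) -ed in_nf.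
- have [eqi|lt] : (i.+1 = k.+1 - d \/ i.+1 < k.+1 - d)%N by lia.
    have -> : i = (k.+1 - d.+1)%N by lia.
    by rewrite -mulrA -/(tail_word k.+1 d.+1) in_nf //; lia.
  by rewrite -mulrA tail_comm ?mulrA ?in_nf ?IH //; lia.
- by rewrite -mulrA tail_shift ?mulrA ?in_nf ?IH //; lia.
Qed.

Lemma normal_form_word k (s : seq nat) : all (fun i => i < k)%N s ->
  \prod_(i <- s) T i \in normal_forms k.
Proof.
elim/last_ind: s => [|s i IH]; first by rewrite big_nil one_normal_form.
rewrite all_rcons -cats1 big_cat big_seq1 => /andP[ik sk].
by apply: normal_form_mul => //; apply: IH.
Qed.

End NormalForms.

(** * The action *)

Section LinearExtension.
Variable n : nat.
Implicit Types (f g : F n -> F n) (v : QF n) (w : F n).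

Lemma lin_ext_linear f : linear (lin_ext f).
Proof.
move=> c u v; rewrite /lin_ext scaler_sumr -big_split /=; apply: eq_bigr => w _.
by rewrite !ffunE scalerDl scalerA.
Qed.

Lemma basisF_sum v : v = \sum_w v w *: basisF w.
Proof.
apply/ffunP => u; rewrite sum_ffunE (bigD1 u) //= big1 => [|w wu].
  by rewrite !ffunE eqxx addr0 [_ *: _]mulr1.
by rewrite !ffunE eq_sym (negPf wu) scaler0.
Qed.

Lemma lin_ext_basis f w : lin_ext f (basisF w) = basisF (f w).
Proof.
rewrite /lin_ext (bigD1 w) //= big1 => [|u uw].
  by rewrite ffunE eqxx scale1r addr0.
by rewrite ffunE (negPf uw) scale0r.
Qed.

HB.instance Definition _ f :=
  GRing.isLinear.Build rat (QF n) (QF n) *:%R (@lin_ext n f) (lin_ext_linear f).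

Lemma lin_ext_comp f g v : lin_ext (f \o g) v = lin_ext f (lin_ext g v).
Proof.
rewrite [in RHS](_ : lin_ext g v = \sum_w v w *: basisF (g w)) // linear_sum.
by apply: eq_bigr => w _; rewrite linearZ /= lin_ext_basis.
Qed.

Lemma lin_ext_id v : lin_ext id v = v.
Proof. by rewrite [RHS]basisF_sum. Qed.

Lemma eq_lin_ext f g v : f =1 g -> lin_ext f v = lin_ext g v.
Proof. by move=> fg; apply: eq_bigr => w _; rewrite fg. Qed.

Lemma basisF_inj : injective (@basisF n).
Proof.
move=> u w /ffunP/(_ u); rewrite !ffunE eqxx.
by case: (u =P w) => // _ /eqP; rewrite oner_eq0.
Qed.

End LinearExtension.

Section FreeAction.
Variable n : nat.
Let m := n.-1.
Let fw := {fmonom 'I_m.-1}.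
Implicit Types (k : fw) (x y : freealg m) (v : QF n) (w : F n).

Definition word_down k w : F n := foldr (@down n) w (k : seq 'I_m.-1).

Lemma word_downM k1 k2 w :
  word_down (mmul k1 k2) w = word_down k1 (word_down k2 w).
Proof. by rewrite /word_down fmM foldr_cat. Qed.

(** The linear extension to the monoid algebra, computed one coordinate at a
    time so that linearity in the first argument is that of [mmap]. *)
Definition free_act x v : QF n :=
  [ffun u => mmap idfun (fun k => lin_ext (word_down k) v u : rat) x].

Lemma free_act_gen c k v : free_act << c *g k >> v = c *: lin_ext (word_down k) v.
Proof. by apply/ffunP => u; rewrite !ffunE mmapU. Qed.

Lemma free_act_linear_l v : linear (free_act^~ v).
Proof.
move=> c x y; apply/ffunP => u; rewrite !ffunE mmapD; congr (_ + _).
rewrite (mmapEw (msuppZ_le _ _)) mmapE scaler_sumr.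
by apply: eq_bigr => k _; rewrite mcoeffZ /= /GRing.scale /= mulrA.
Qed.

Lemma free_act_linear_r x : linear (free_act x).
Proof.
move=> c u v; apply/ffunP => t; rewrite !ffunE /mmap scaler_sumr -big_split /=.
apply: eq_bigr => k _; rewrite (lin_ext_linear (word_down k)) !ffunE mulrDr.
by rewrite /GRing.scale /= mulrCA.
Qed.

Lemma free_act0 v : free_act 0 v = 0.
Proof. by apply/ffunP => u; rewrite !ffunE mmap0. Qed.

Lemma free_actD x y v : free_act (x + y) v = free_act x v + free_act y v.
Proof. by have := free_act_linear_l v 1 x y; rewrite !scale1r. Qed.

Lemma free_actN x v : free_act (- x) v = - free_act x v.
Proof. by have := free_act_linear_l v (-1) x 0; rewrite !scaleN1r free_act0 !addr0. Qed.

Lemma free_act_0r x : free_act x 0 = 0.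
Proof. by have := free_act_linear_r x (-1) 0 0; rewrite !scaleN1r !oppr0 !addr0 addNr. Qed.

Lemma free_actDr x u v : free_act x (u + v) = free_act x u + free_act x v.
Proof. by have := free_act_linear_r x 1 u v; rewrite !scale1r. Qed.

Lemma free_ind (P : freealg m -> Prop) : P 0 -> (forall x y, P x -> P y -> P (x + y)) ->
  (forall c k, P << c *g k >>) -> forall x, P x.
Proof.
move=> P0 PD PU x; rewrite (monalgE x); elim: (enum_fset _) => [|k s IH].
  by rewrite big_nil.
by rewrite big_cons; apply: PD; [apply: PU|apply: IH].
Qed.

Lemma free_actM x y v : free_act (x * y) v = free_act x (free_act y v).
Proof.
elim/free_ind: x => [|x1 x2 h1 h2|c k]; first by rewrite mul0r !free_act0.
  rewrite mulrDl [RHS]free_actD [LHS]free_actD; exact: (congr2 +%R h1 h2).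
elim/free_ind: y => [|y1 y2 h1 h2|c' k']; first by rewrite mulr0 !free_act0 free_act_0r.
  rewrite mulrDr [LHS]free_actD [X in _ = free_act _ X]free_actD free_actDr.
  exact: (congr2 +%R h1 h2).
have -> : << c *g k >> * << c' *g k' >> = << c * c' *g mmul k k' >> :> freealg m.
  by rewrite malgM_def fgmulUU.
rewrite !free_act_gen linearZ /= scalerA.
by rewrite (eq_lin_ext _ (word_downM k k')) (lin_ext_comp (word_down k)).
Qed.

Lemma free_act_letter (i : 'I_m.-1) v : free_act (gen i) v = lin_ext (@down n i) v.
Proof.
rewrite free_act_gen scale1r; apply: eq_lin_ext => w.
by rewrite /word_down fmU.
Qed.

Lemma free_act_mul_letter x f (i : 'I_m.-1) :
  (forall v, free_act x v = lin_ext f v) ->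
  forall v, free_act (x * gen i) v = lin_ext (f \o @down n i) v.
Proof.
move=> fx v; apply: etrans (free_actM x (gen i) v) _; apply: etrans (fx _) _.
by rewrite lin_ext_comp; congr lin_ext; apply: free_act_letter.
Qed.

Lemma free_act_hecke x y v : hecke0_rel x y -> free_act x v = free_act y v.
Proof.
have act1 := free_act_letter; have act2 j i := free_act_mul_letter i (act1 j).
have act3 i1 j i := free_act_mul_letter i (act2 i1 j).
case=> [i|i j ij|i j ij].
- apply: etrans (act2 i i v) _; apply: etrans _ (esym (act1 i v)).
  by apply: eq_lin_ext => w; apply: down_idem.
- apply: etrans (act2 i j v) _; apply: etrans _ (esym (act2 j i v)).
  apply: eq_lin_ext => w; case/orP: ij => /down_comm ij; first exact: ij.
  exact: esym (ij w).
- apply: etrans (act3 i j i v) _; apply: etrans _ (esym (act3 j i j v)).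
  by apply: eq_lin_ext => w; apply: down_braid.
Qed.

Lemma free_act_ideal x v : span_ideal (@hecke0_rel m) x -> free_act x v = 0.
Proof.
elim=> [|a b x1 y1 r|x1 y1 _ h1 _ h2]; first exact: free_act0.
  rewrite !free_actM free_actD free_actN (free_act_hecke _ r) subrr.
  exact: free_act_0r.
by rewrite free_actD h1 h2 addr0.
Qed.

Definition hecke_act (a : Hecke0 m) v : QF n := free_act (repr a) v.

Lemma hecke_act_toH x v : hecke_act (toH x) v = free_act x v.
Proof.
apply/eqP; rewrite -subr_eq0 -free_actN -free_actD.
by rewrite (free_act_ideal _ (repr_toH x)).
Qed.

Lemma toHMr x y : toH (x * y) = toH x * toH y :> Hecke0 m.
Proof. by rewrite [in RHS]/GRing.mul /= toHM. Qed.

Lemma toHZr c x : toH (c *: x) = c *: toH x :> Hecke0 m.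
Proof. by rewrite [in RHS]/GRing.scale /= toHZ. Qed.

Lemma hecke_act_action : is_action hecke_act.
Proof.
split.
- move=> v c a b; rewrite -(toHK a) -(toHK b) -toHZr -toHD !hecke_act_toH.
  exact: free_act_linear_l.
- by move=> a; apply: free_act_linear_r.
- move=> v; rewrite -[1]/(toH 1) hecke_act_toH free_act_gen scale1r -[RHS]lin_ext_id.
  by apply: eq_lin_ext => w; rewrite /word_down fm1.
- move=> a b v; rewrite -(toHK a) -(toHK b) -toHMr !hecke_act_toH.
  exact: free_actM.
Qed.

End FreeAction.

(** * Faithfulness *)

Lemma uniq_map_inj (S T : eqType) (f : S -> T) (s : seq S) :
  uniq (map f s) -> {in s &, injective f}.
Proof.
elim: s => //= x s IH /andP[fx us] a b; rewrite !inE.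
by case/predU1P=> [->|a_s] /predU1P[->|b_s] // e;
  [case/negP: fx; rewrite e map_f | case/negP: fx; rewrite -e map_f | apply: IH].
Qed.

Section Faithful.
Variable n : nat.
Hypothesis hn : (1 < n)%N.
Let m := n.-1.
Implicit Types (k : {fmonom 'I_m.-1}) (x y : freealg m) (a b : Hecke0 m) (w : F n).

Lemma hecke_relE x y : hecke0_rel x y -> toH x = toH y.
Proof.
move=> r; apply/toHE; rewrite -[_ - _]mul1r -[_ * _]mulr1.
exact: SpanIdealGen.
Qed.

(** Out of range generators are set to [1], which satisfies all the relations,
    so that normal forms can be indexed by natural numbers. *)
Definition nat_gen (i : nat) : Hecke0 m :=
  if insub i is Some j then heckeT (j : 'I_m.-1) else 1.

Lemma nat_genE (i : 'I_m.-1) : nat_gen i = heckeT i.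
Proof. by rewrite /nat_gen valK. Qed.

Lemma nat_gen_idem i : nat_gen i * nat_gen i = nat_gen i.
Proof.
rewrite /nat_gen; case: insubP => [j _ _|_]; last exact: mulr1.
by rewrite -toHMr; apply: hecke_relE; apply: HeckeIdem.
Qed.

Lemma nat_gen_comm i j : (i.+1 < j)%N -> nat_gen i * nat_gen j = nat_gen j * nat_gen i.
Proof.
rewrite /nat_gen; case: insubP => [i' _ <-|_]; last by rewrite mul1r mulr1.
case: insubP => [j' _ <-|_]; last by rewrite mul1r mulr1.
by move=> ij; rewrite -!toHMr; apply: hecke_relE; apply: HeckeComm; rewrite ij.
Qed.

Lemma nat_gen_braid i :
  nat_gen i * nat_gen i.+1 * nat_gen i = nat_gen i.+1 * nat_gen i * nat_gen i.+1.
Proof.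
have [im|mi] := ltnP i.+1 m.-1; last first.
  have -> : nat_gen i.+1 = 1 by rewrite /nat_gen insubN // -leqNgt.
  rewrite (mulr1 (nat_gen i)) (mul1r (nat_gen i)) (mulr1 (nat_gen i)).
  exact: nat_gen_idem.
have -> : nat_gen i = heckeT (Ordinal (ltnW im)) by rewrite -nat_genE.
have -> : nat_gen i.+1 = heckeT (Ordinal im) by rewrite -nat_genE.
have e3 (a b c : 'I_m.-1) :
    toH (gen a * gen b * gen c) = heckeT a * heckeT b * heckeT c :> Hecke0 m.
  by rewrite (toHMr (gen a * gen b) (gen c)) (toHMr (gen a) (gen b)).
apply: etrans (esym (e3 _ _ _)) _; apply: etrans _ (e3 _ _ _).
by apply: hecke_relE; apply: HeckeBraid.
Qed.

Definition hecke_forms : seq (Hecke0 m) := normal_forms nat_gen m.-1.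

Lemma size_hecke_forms : size hecke_forms = m`!.
Proof. by rewrite size_normal_forms prednK // /m -ltnS prednK // ltnW. Qed.

Lemma monomial_form k : toH << k >> \in hecke_forms.
Proof.
have -> : toH << k >> = \prod_(i <- map val (k : seq 'I_m.-1)) nat_gen i :> Hecke0 m.
  rewrite -[k in LHS]fmK; elim: (k : seq _) => [|i s IH].
    by rewrite big_nil -fmoneE.
  rewrite /= big_cons -IH nat_genE -toHMr; congr toH.
  rewrite /gen malgM_def fgmulUU mulr1; congr << _ >>.
  by apply/eqP; rewrite fmP fmM fmU.
apply: normal_form_word.
- exact: nat_gen_idem.
- exact: nat_gen_comm.
- exact: nat_gen_braid.
- by apply/allP => i /mapP[j _ ->] /=.
Qed.

(** A chain whose labels form the reversal. *)
Definition top_chain : F n := [arg max_(w > e n) len w]%N.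

Lemma top_chain_desc i : (phi top_chain (hi i) < phi top_chain (lo i))%N.
Proof.
rewrite /top_chain; case: arg_maxnP => // w _ max.
have [asc|//] := asc_or_desc (phi w) i.
have [v [_ _ ev]] := adj_neighbor i w.
by have := max v isT; rewrite /len ev inv_swap // /geq /= ltnn.
Qed.

(** Going up from a permutation through its ascents ends at the reversal, which
    labels [top_chain]; the down operators retrace these steps. *)
Lemma top_chain_reach (s : 'S_m) : exists k, phi (word_down k top_chain) = s.
Proof.
have [d] := ubnP (#|{: 'I_m * 'I_m}| - inv s); elim: d s => // d IH s sd.
have [[i asc]|no] := pselect (exists i, s (lo i) < s (hi i))%N; last first.
  exists mone; rewrite /word_down fm1 /=; apply: reversal_unique => i.
    exact: top_chain_desc.
  by have [asc|//] := asc_or_desc s i; case: no; exists i.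
have bound : (inv (adj i * s)%g <= #|{: 'I_m * 'I_m}|)%N by apply: max_card.
have [|k ek] := IH (adj i * s)%g; first by rewrite inv_swap // in bound *; lia.
have desc : (phi (word_down k top_chain) (hi i) < phi (word_down k top_chain) (lo i))%N.
  by rewrite ek !permM /adj tpermL tpermR.
exists (mmul (fmu i) k); rewrite word_downM {1}/word_down fmU /=.
by have [_ -> _] := down_desc desc; rewrite ek mulgA tperm2 mul1g.
Qed.

(** The chain to which a monomial carries [top_chain]. *)
Definition top_image a : F n :=
  odflt top_chain [pick u | hecke_act a (basisF top_chain) == basisF u].

Lemma top_image_word k : top_image (toH << k >>) = word_down k top_chain.
Proof.
rewrite /top_image hecke_act_toH free_act_gen scale1r lin_ext_basis.
case: pickP => [u /eqP/basisF_inj->//|/(_ (word_down k top_chain))].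
by rewrite eqxx.
Qed.

(** There are at most [m`!] normal forms, and they carry [top_chain] to chains with
    all [m`!] labels; so they carry it to distinct chains. *)
Lemma top_image_uniq : uniq [seq phi (top_image a) | a <- hecke_forms].
Proof.
apply: (@leq_size_uniq _ (enum {: 'S_m})) => [|s _|]; first exact: enum_uniq.
  have [k <-] := top_chain_reach s; rewrite -top_image_word.
  exact: (map_f (fun a => phi (top_image a)) (monomial_form k)).
by rewrite size_map size_hecke_forms -cardE card_Sn.
Qed.

(** Every element is a combination of normal forms; the second identity records
    its effect on [top_chain] with the same coefficients, which are therefore
    read off the distinct basis vectors. *)
Lemma form_expansion x : exists c : Hecke0 m -> rat,
  toH x = \sum_(b <- hecke_forms) c b *: b /\
  free_act x (basisF top_chain) = \sum_(b <- hecke_forms) c b *: basisF (top_image b).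
Proof.
have uniqf := map_uniq top_image_uniq.
elim/free_ind: x => [|x y [c [ec ac]] [c' [ec' ac']]|r k].
- exists (fun=> 0); rewrite free_act0; split.
    have -> : toH 0 = 0 :> Hecke0 m.
      by apply: (addrI (toH 0)); rewrite -toHD !addr0.
    by rewrite big1 // => b _; rewrite scale0r.
  by rewrite big1 // => b _; rewrite scale0r.
- exists (fun b => c b + c' b); rewrite toHD free_actD ec ec' ac ac'.
  by split; rewrite -big_split; apply: eq_bigr => b _; rewrite scalerDl.
exists (fun b => if b == toH << k >> then r else 0).
have pick_one (V : lmodType rat) (f : Hecke0 m -> V) :
    \sum_(b <- hecke_forms) (if b == toH << k >> then r else 0) *: f b = r *: f (toH << k >>).
  rewrite (bigD1_seq _ (monomial_form k) uniqf) /= eqxx big1 ?addr0 // => b /negPf->.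
  exact: scale0r.
rewrite (pick_one _ id) pick_one top_image_word free_act_gen lin_ext_basis; split=> //.
rewrite -toHZr; congr toH; apply/malgP => k'.
by rewrite mcoeffZ (mcoeffU k r k') (mcoeffU k 1 k') mulrnAr mulr1.
Qed.

Lemma hecke_act_faithful : is_faithful (@hecke_act n).
Proof.
move=> a a0; have := a0 (basisF top_chain); rewrite -(toHK a) hecke_act_toH.
have [c [-> ->]] := form_expansion (repr a) => eq0.
rewrite big_seq big1 // => b bf; suff -> : c b = 0 by rewrite scale0r.
have := congr1 (fun v : QF n => v (top_image b)) eq0.
have uniqf := map_uniq top_image_uniq.
rewrite sum_ffunE ffunE (bigD1_seq _ bf uniqf) /= big_seq_cond big1.
  by rewrite addr0 !ffunE eqxx [_ *: _]mulr1.
move=> b' /andP[b'f nb]; rewrite !ffunE.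
case: eqP => [eqi|_]; last exact: scaler0.
case/eqP: nb; apply: (uniq_map_inj top_image_uniq) => //.
by rewrite eqi.
Qed.

End Faithful.

Local Close Scope ring_scope.

Theorem theorem5p10 (n : nat) (hn : 2 <= n) :
  (exists act : Hecke0 n.-1 -> QF n -> QF n,
     [/\ is_action act,
         forall (i : 'I_n.-2) (v : QF n), act (heckeT i) v = lin_ext (down i) v
       & is_faithful act]) /\
  (forall (w : F n) (i : 'I_n.-2) (u : F n),
     lower_interval w u -> lower_interval w (down i u)).
Proof.
split; last by move=> w i u; apply: weak_le_trans; apply: down_le.
exists (@hecke_act n); split; first exact: hecke_act_action.
  by move=> i v; rewrite hecke_act_toH free_act_letter.
exact: hecke_act_faithful.
Qed.
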